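(* Let $n$ be a positive integer and assume that the limit $$\xi = \lim_{r\to\infty} r^{2}\,\frac{d\phi_n}{dr}(r)$$ exists and is finite. Then $$n! = (n+1)^{n+\frac{1}{2}}\, e^{-n-1}\, e^{\xi}.$$
   Context: For a positive integer $n$, the function $\phi_n : [1,\infty) \to \mathbb{R}$ is defined by the identity $$\sum_{i=1}^{n} i^{\frac{1}{r}} = \frac{r}{r+1}(n+1)^{\frac{1+r}{r}} - \frac{1}{2}(n+1)^{\frac{1}{r}} - \phi_n(r),$$ i.e. $\phi_n(r) = \frac{r}{r+1}(n+1)^{\frac{1+r}{r}} - \frac{1}{2}(n+1)^{\frac{1}{r}} - \sum_{i=1}^{n} i^{\frac{1}{r}}$ for real $r \geq 1$. The quantity $\xi$ may depend on $n$. *)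

(* Defs.v *)
From Stdlib Require Import Reals.
From Coquelicot Require Import Coquelicot.
Open Scope R_scope.

(* Used for [1 <= n] and [1 <= r]; the defining formula also assigns (irrelevant)
   values for [r < 1].  All bases of [Rpower] below are positive. *)
Definition phi (n : nat) (r : R) : R :=
  r / (r + 1) * Rpower (INR (n + 1)) ((1 + r) / r)
  - 1 / 2 * Rpower (INR (n + 1)) (1 / r)
  - sum_n_m (fun i : nat => Rpower (INR i) (1 / r)) 1 n.

(* Main.v *)
Require Import Defs.
From Stdlib Require Import Reals Factorial Lra Lia.
From Coquelicot Require Import Coquelicot.
Open Scope R_scope.

(** The substitution [s = 1 / r] turns [phi n] into a function [phi_inv n]
    that is smooth on a neighbourhood of [s = 0], the point that corresponds to
    [r = +oo].  By the chain rule, [r ^ 2 * phi'(r) = - phi_inv'(1 / r)], so the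
    limit [xi] is [- phi_inv'(0)] ([is_lim_sqr_Derive_phi]).  At [s = 0] the
    derivative of [i ^ s] is [ln i], hence the power sum contributes
    [ln 1 + ... + ln n = ln n!] ([sum_ln_fact]), and
<<
      xi = ln n! - (n + 1 / 2) * ln (n + 1) + (n + 1),
>>
    whose exponential is the claimed formula. *)

(** [phi n (1 / s)], with the real powers written as exponentials. *)
Definition phi_inv (n : nat) (s : R) : R :=
  / (1 + s) * exp ((1 + s) * ln (INR (n + 1)))
  - 1 / 2 * exp (s * ln (INR (n + 1)))
  - sum_n_m (fun i : nat => exp (s * ln (INR i))) 1 n.

Definition dphi_inv (n : nat) (s : R) : R :=
  (ln (INR (n + 1)) / (1 + s) - / (1 + s) ^ 2)
    * exp ((1 + s) * ln (INR (n + 1)))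
  - 1 / 2 * (ln (INR (n + 1)) * exp (s * ln (INR (n + 1))))
  - sum_n_m (fun i : nat => ln (INR i) * exp (s * ln (INR i))) 1 n.

(** The weights [w] let the same lemma differentiate the power sum and show that
    its derivative is continuous. *)
Lemma is_derive_exp_sum (w l : nat -> R) (n : nat) (s : R) :
  is_derive (fun s => sum_n_m (fun i => w i * exp (s * l i)) 1 n) s
    (sum_n_m (fun i => w i * (l i * exp (s * l i))) 1 n).
Proof.
  induction n as [|n IH].
  - rewrite sum_n_m_zero by lia.
    apply (is_derive_ext (fun _ => 0)).
    + intros t. now rewrite sum_n_m_zero by lia.
    + apply @is_derive_const.
  - rewrite sum_n_Sm by lia.
    apply (is_derive_ext (fun s => plus
      (sum_n_m (fun i => w i * exp (s * l i)) 1 n)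
      (w (S n) * exp (s * l (S n))))).
    + intros t. now rewrite sum_n_Sm by lia.
    + apply (is_derive_plus (K := R_AbsRing) (V := R_NormedModule)).
      * exact IH.
      * auto_derive; [easy | ring].
Qed.

Lemma is_derive_phi_inv (n : nat) (s : R) :
  -1 < s -> is_derive (phi_inv n) s (dphi_inv n s).
Proof.
  intros Hs. unfold phi_inv, dphi_inv.
  apply (is_derive_minus (K := R_AbsRing) (V := R_NormedModule)).
  - auto_derive; [lra | field; lra].
  - pose proof (is_derive_exp_sum (fun _ => 1) (fun i => ln (INR i)) n s) as H.
    rewrite (sum_n_m_ext _ (fun i => ln (INR i) * exp (s * ln (INR i)))) in H
      by (intros i; apply Rmult_1_l).
    eapply is_derive_ext; [|exact H].
    intros t. apply sum_n_m_ext. intros i. apply Rmult_1_l.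
Qed.

Lemma continuous_dphi_inv_0 (n : nat) : continuous (dphi_inv n) 0.
Proof.
  unfold dphi_inv.
  apply (continuous_minus (V := R_NormedModule)).
  - apply (ex_derive_continuous (V := R_NormedModule)).
    auto_derive. repeat split; try easy; try lra.
  - apply (ex_derive_continuous (V := R_NormedModule)).
    eexists. apply is_derive_exp_sum.
Qed.

Lemma phi_phi_inv (n : nat) (r : R) : 0 < r -> phi n r = phi_inv n (/ r).
Proof.
  intros Hr. unfold phi, phi_inv, Rpower.
  replace ((1 + r) / r) with (1 + / r) by (field; lra).
  replace (r / (r + 1)) with (/ (1 + / r)) by (field; lra).
  unfold Rdiv at 2. rewrite Rmult_1_l. f_equal.
  apply sum_n_m_ext. intros i. now replace (1 / r) with (/ r) by (field; lra).
Qed.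

(** The factor [r ^ 2] cancels the derivative [- 1 / r ^ 2] of the
    substitution. *)
Lemma sqr_Derive_phi (n : nat) (r : R) :
  0 < r -> r ^ 2 * Derive (phi n) r = - dphi_inv n (/ r).
Proof.
  intros Hr.
  assert (Hinv : 0 < / r) by now apply Rinv_0_lt_compat.
  assert (H : is_derive (phi n) r (- / r ^ 2 * dphi_inv n (/ r))).
  { apply (is_derive_ext_loc (fun r => phi_inv n (/ r))).
    - exists (mkposreal r Hr). intros y Hy. symmetry. apply phi_phi_inv.
      apply Rabs_lt_between' in Hy. simpl in Hy. lra.
    - apply (is_derive_comp (K := R_AbsRing) (V := R_NormedModule)).
      + apply is_derive_phi_inv. lra.
      + auto_derive; [lra | field; lra]. }
  rewrite (is_derive_unique _ _ _ H). field. lra.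
Qed.

Lemma is_lim_sqr_Derive_phi (n : nat) :
  is_lim (fun r => r ^ 2 * Derive (phi n) r) p_infty (- dphi_inv n 0).
Proof.
  apply (is_lim_ext_loc (fun r => - dphi_inv n (/ r))).
  - exists 0. intros r Hr. symmetry. now apply sqr_Derive_phi.
  - apply (is_lim_opp (fun r => dphi_inv n (/ r)) p_infty (dphi_inv n 0)).
    apply (filterlim_comp _ _ _ Rinv (dphi_inv n) _ (locally 0)).
    + apply (is_lim_inv (fun r => r) p_infty p_infty);
        [apply is_lim_id | discriminate].
    + apply continuous_dphi_inv_0.
Qed.

Lemma sum_ln_fact (n : nat) :
  sum_n_m (fun i => ln (INR i)) 1 n = ln (INR (fact n)).
Proof.
  induction n as [|n IH].
  - rewrite sum_n_m_zero by lia. symmetry. apply ln_1.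
  - rewrite sum_n_Sm by lia. rewrite IH, fact_simpl, mult_INR, ln_mult.
    + apply Rplus_comm.
    + apply lt_0_INR. lia.
    + apply INR_fact_lt_0.
Qed.

Lemma dphi_inv_0 (n : nat) :
  dphi_inv n 0 =
    (INR n + 1 / 2) * ln (INR (n + 1)) - (INR n + 1) - ln (INR (fact n)).
Proof.
  unfold dphi_inv.
  rewrite (sum_n_m_ext _ (fun i => ln (INR i))), sum_ln_fact.
  - rewrite Rplus_0_r, Rmult_1_l, Rmult_0_l, exp_0.
    rewrite exp_ln by (apply lt_0_INR; lia).
    replace (INR (n + 1)) with (INR n + 1) by now rewrite plus_INR.
    field.
  - intros i. now rewrite Rmult_0_l, exp_0, Rmult_1_r.
Qed.

Theorem mainTheorem2 (n : nat) (hn : (1 <= n)%nat) (xi : R)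
    (hxi : is_lim (fun r : R => r ^ 2 * Derive (phi n) r) p_infty (Finite xi)) :
  INR (fact n) =
    Rpower (INR (n + 1)) (INR n + 1 / 2) * exp (- INR n - 1) * exp xi.
Proof.
  assert (Hxi : xi = - dphi_inv n 0).
  { apply is_lim_unique in hxi.
    rewrite (is_lim_unique _ _ _ (is_lim_sqr_Derive_phi n)) in hxi.
    now injection hxi. }
  unfold Rpower. rewrite <- !exp_plus, Hxi, dphi_inv_0.
  rewrite <- (exp_ln (INR (fact n))) at 1 by apply INR_fact_lt_0.
  f_equal. ring.
Qed.
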